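(* Let $n,d$ be positive integers with $1\le d<\frac{n-1}{2}$. Then the set of integer eigenvalues of the circuit distance power $C_n^{(d)}$ is a subset of $\{-3,-2,-1,0,1,2d\}$.
   Context: $C_n$ denotes the circuit (cycle) graph on $n$ vertices. For a graph $G$ and a positive integer $d$, the $d$-th distance power $G^{(d)}$ is the graph obtained from $G$ by adding edges between all pairs of distinct vertices whose distance in $G$ is at most $d$. The eigenvalues of a graph are those of its adjacency matrix. The condition $1\le d<\frac{n-1}{2}$ expresses that $C_n^{(d)}$ is non-complete. *)

(* Defs.v *)
From mathcomp Require Import all_boot all_order all_algebra.

Set Implicit Arguments.
Unset Strict Implicit.
Unset Printing Implicit Defensive.

(* A finite simple graph on T is a symmetric irreflexive relation e : rel T.  *)

Definition walk (T : finType) (e : rel T) (k : nat) (x y : T) : bool :=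
  [exists p : k.-tuple T, path e x p && (last x p == y)].

(* The least length of a walk from x to y. If x and y are connected it is     *)
(* smaller than #|T| (gdist_connect below); otherwise gdist e x y = #|T|, a   *)
(* default value that dist_power discards by testing connect e x y.           *)
Definition gdist (T : finType) (e : rel T) (x y : T) : nat :=
  find (fun k => walk e k x y) (iota 0 #|T|).

Definition dist_power (T : finType) (e : rel T) (d : nat) : rel T :=
  [rel x y | e x y || [&& x != y, connect e x y & gdist e x y <= d]].

(* ordS i is i + 1 modulo n. The condition i != j only matters for n = 1. *)
Definition circuit (n : nat) : rel 'I_n :=
  [rel i j | (i != j) && ((j == ordS i) || (i == ordS j))].

Arguments circuit : clear implicits.

Definition adjmx (R : nzRingType) (n : nat) (e : rel 'I_n) : 'M[R]_n :=
  (\matrix_(i, j) (e i j)%:R)%R.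

Lemma walkP (T : finType) (e : rel T) k x y :
  reflect (exists p, [/\ path e x p, last x p = y & size p = k])
          (walk e k x y).
Proof.
apply: (iffP existsP) => [[p /andP[ep /eqP lp]]|[p [ep lp /eqP sp]]].
  by exists p; rewrite size_tuple.
by exists (Tuple sp); rewrite ep lp eqxx.
Qed.

Lemma gdist_connect (T : finType) (e : rel T) x y :
  connect e x y ->
  [/\ gdist e x y < #|T|, walk e (gdist e x y) x y
    & forall k, walk e k x y -> gdist e x y <= k].
Proof.
case/connectP=> p0 ep0 ->; case: (shortenP ep0) => p ep up _ {p0 ep0}.
set y' := last x p.
have sp : size p < #|T|.
  by have := max_card (mem (x :: p)); rewrite (card_uniqP up).
have hw : has (fun k => walk e k x y') (iota 0 #|T|).
  apply/hasP; exists (size p); first by rewrite mem_iota add0n.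
  by apply/walkP; exists p.
have lt : gdist e x y' < #|T| by rewrite -[X in _ < X](size_iota 0) -has_find.
split=> // [|k wk]; first by have := nth_find 0 hw; rewrite nth_iota.
rewrite leqNgt; apply/negP => ltk.
have := before_find 0 ltk; rewrite nth_iota ?wk //.
exact: ltn_trans ltk lt.
Qed.

Lemma circuit_irr n : irreflexive (circuit n).
Proof. by move=> i; rewrite /circuit /= eqxx. Qed.

Lemma circuit_sym n : symmetric (circuit n).
Proof. by move=> i j; rewrite /circuit /= eq_sym orbC. Qed.

Lemma walk_sym (T : finType) (e : rel T) k x y :
  symmetric e -> walk e k x y = walk e k y x.
Proof.
move=> se; suff imp u v : walk e k u v -> walk e k v u.
  by apply/idP/idP; apply: imp.
case/walkP=> p [ep <- <-]; apply/walkP; exists (rev (belast u p)).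
split; first by rewrite rev_path (eq_path (e' := e)) // => a b /=; apply: se.
  by case: p {ep} => //= a p; rewrite rev_cons last_rcons.
by rewrite size_rev size_belast.
Qed.

Lemma dist_power_irr (T : finType) (e : rel T) d :
  irreflexive e -> irreflexive (dist_power e d).
Proof. by move=> ie x; rewrite /dist_power /= ie eqxx. Qed.

Lemma dist_power_sym (T : finType) (e : rel T) d :
  symmetric e -> symmetric (dist_power e d).
Proof.
move=> se x y; rewrite /dist_power /= se eq_sym (sym_connect_sym se).
by congr (_ || [&& _, _ & _ <= d]); apply: eq_find => k; apply: walk_sym.
Qed.

(* Main.v *)
Require Import Defs.
From mathcomp Require Import all_boot all_order all_algebra.
From mathcomp Require Import zify ring.

(** Write A for the adjacency matrix and c = z + 1. An integer eigenvalue z of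
    the integer matrix A has a nonzero integer eigenvector, which we read as an
    n-periodic sequence u : nat -> int. Since 2d + 1 <= n, row m + d of A + 1
    sums u over the window m, ..., m + 2d of distinct vertices
    (adjmx_circuit_window), so that
      u m + ... + u (m + 2d) = c * u (m + d)   for all m.
    Subtracting two consecutive equations telescopes the window:
      u (m + 2d + 1) - u m = c * (u (m + d + 1) - u (m + d)).

    If |c| <= 2, then z lies in {-3, ..., 1}. If |c| >= 3, put
    u' m = u (m + d + 1) - u (m + d). This is again an integer n-periodic
    sequence that satisfies the same recurrence, and |c| |u'| <= 2 max |u|, so
    the maximum of |u'| is strictly smaller than that of |u| unless u = 0.
    Integrality makes this a descent (periodic_descent): by induction u' is
    constant, hence zero because u is periodic, hence u is constant. Then
    (2d + 1) u 0 = c * u 0 with u 0 != 0, which is z = 2d.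

    In terms of roots of unity, this is the remark that if zeta <> 1 gives the
    eigenvalue z, then zeta^d (zeta - 1) = (zeta^(2d+1) - 1) / c is a nonzero
    algebraic integer all of whose conjugates have modulus at most 2 / |c|,
    which forces |c| <= 2; the descent replaces the norm argument. *)

Import GRing.Theory Num.Theory.
Local Open Scope ring_scope.

(** * Walks and distance powers *)

Lemma walk0 (T : finType) (e : rel T) (x y : T) : walk e 0 x y = (x == y).
Proof.
apply/walkP/eqP => [[p [_ <- /size0nil ->]] //|->].
by exists [::].
Qed.

Lemma walkSP (T : finType) (e : rel T) (k : nat) (x y : T) :
  reflect (exists2 z, e x z & walk e k z y) (walk e k.+1 x y).
Proof.
apply: (iffP (walkP _ _ _ _)) => [[[|z p] [//= /andP[exz ep] lp [sp]]]|].
  by exists z => //; apply/walkP; exists p.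
by case=> z exz /walkP[p [ep lp sp]]; exists (z :: p); rewrite /= exz ep sp.
Qed.

(** For d > 0, the clause of dist_power for the original edges is absorbed by
    walks of length 1, and a walk of any length k <= d bounds the distance. *)
Lemma dist_powerP (T : finType) (e : rel T) (d : nat) (x y : T) :
  irreflexive e -> (0 < d)%N ->
  reflect (x <> y /\ exists2 k, (k <= d)%N & walk e k x y)
          (dist_power e d x y).
Proof.
move=> ie d_gt0; apply: (iffP orP) => [[exy | /and3P[/eqP xy cxy le_d]]|].
- split; first by move=> xy; rewrite xy ie in exy.
  by exists 1%N => //; apply/walkSP; exists y; rewrite ?walk0.
- split=> //; exists (gdist e x y) => //.
  by have [] := gdist_connect cxy.
case=> /eqP xy [k le_kd wk]; right.
have cxy : connect e x y.
  by have /walkP[p [ep lp _]] := wk; apply/connectP; exists p.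
have [_ _ /(_ _ wk) le_k] := gdist_connect cxy.
by rewrite xy cxy (leq_trans le_k).
Qed.

(** * Balls in the circuit *)

(** Naming vertices by arbitrary naturals turns the neighbourhood of a vertex
    into an interval of indices, with no wrap-around to treat separately. *)
Definition cyc {n : nat} (n_gt0 : (0 < n)%N) (i : nat) : 'I_n :=
  Ordinal (ltn_pmod i n_gt0).

Lemma cyc_val (n : nat) (n_gt0 : (0 < n)%N) (x : 'I_n) : cyc n_gt0 x = x.
Proof. by apply: val_inj; rewrite /= modn_small. Qed.

Lemma cycD (n : nat) (n_gt0 : (0 < n)%N) (i : nat) :
  cyc n_gt0 (i + n) = cyc n_gt0 i.
Proof. by apply: val_inj; rewrite /= modnDr. Qed.

Lemma cyc_window_inj (n : nat) (n_gt0 : (0 < n)%N) (m L : nat) :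
  (L <= n)%N -> injective (fun t : 'I_L => cyc n_gt0 (m + t)).
Proof.
move=> leLn s t /(congr1 val)/eqP /=; rewrite eqn_modDl => /eqP.
rewrite !modn_small; first exact: val_inj.
all: exact: leq_trans (ltn_ord _) leLn.
Qed.

Lemma ordS_cyc (n : nat) (n_gt0 : (0 < n)%N) (i : nat) :
  ordS (cyc n_gt0 i) = cyc n_gt0 i.+1.
Proof. by apply: val_inj; rewrite /= -addn1 modnDml addn1. Qed.

Lemma circuit_cyc (n : nat) (n_gt0 : (0 < n)%N) (i : nat) :
  (1 < n)%N -> circuit n (cyc n_gt0 i) (cyc n_gt0 i.+1).
Proof.
move=> n_gt1; rewrite /circuit /= ordS_cyc eqxx andbT; apply/eqP.
rewrite -[i in cyc _ i]addn0 -addn1.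
by move/(@cyc_window_inj n n_gt0 i 2 n_gt1 ord0 ord_max).
Qed.

Lemma walk_circuit_up (n : nat) (n_gt0 : (0 < n)%N) (k m : nat) :
  (1 < n)%N -> walk (circuit n) k (cyc n_gt0 m) (cyc n_gt0 (m + k)).
Proof.
move=> n_gt1; elim: k m => [|k IHk] m; first by rewrite walk0 addn0.
apply/walkSP; exists (cyc n_gt0 m.+1); first exact: circuit_cyc.
by rewrite addnS -addSn.
Qed.

(** Each step of a walk moves the index by 1 or -1. The walk starts at m + k,
    so k steps stay within m, ..., m + 2k and never leave the naturals. *)
Lemma walk_circuit_window
    (n : nat) (n_gt0 : (0 < n)%N) (k m : nat) (y : 'I_n) :
  walk (circuit n) k (cyc n_gt0 (m + k)) y ->
  exists2 t, (t <= 2 * k)%N & y = cyc n_gt0 (m + t).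
Proof.
elim: k m => [|k IHk] m.
  by rewrite walk0 => /eqP <-; exists 0%N.
case/walkSP=> z /andP[_ /orP[]/eqP].
  (* A step up: the rest of the walk is centred at (m + 2) + k. *)
  rewrite addnS ordS_cyc -!addSn => -> /IHk[t le_t ->].
  by exists t.+2; [lia | rewrite !addSn !addnS].
(* A step down: the rest of the walk is centred at m + k. *)
rewrite addnS -ordS_cyc => /ordS_inj <- /IHk[t le_t ->].
by exists t => //; lia.
Qed.

Lemma circuit_ballP (n : nat) (n_gt0 : (0 < n)%N) (d m : nat) (y : 'I_n) :
  (1 < n)%N ->
  (exists2 k, (k <= d)%N & walk (circuit n) k (cyc n_gt0 (m + d)) y) <->
  (exists2 t, (t <= 2 * d)%N & y = cyc n_gt0 (m + t)).
Proof.
move=> n_gt1; split=> [[k le_kd]|[t le_t ->]].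
  have -> : (m + d = m + (d - k) + k)%N by lia.
  case/walk_circuit_window=> t le_t ->.
  by exists (d - k + t)%N; [lia | rewrite addnA].
case: (leqP d t) => [le_dt | /ltnW le_td].
  exists (t - d)%N; first by lia.
  have -> : (m + t = m + d + (t - d))%N by lia.
  exact: walk_circuit_up.
exists (d - t)%N; first by lia.
rewrite walk_sym; last exact: circuit_sym.
have -> : (m + d = m + t + (d - t))%N by lia.
exact: walk_circuit_up.
Qed.

(** The closed neighbourhood of m + d is the image of the window
    m, ..., m + 2d, on which cyc is injective because 2d + 1 <= n. *)
Lemma adjmx_circuit_window (R : comNzRingType) (n : nat) (n_gt0 : (0 < n)%N)
    (d m : nat) (v : 'rV[R]_n) :
  (0 < d)%N -> (2 * d < n - 1)%N ->
  (v *m adjmx R (dist_power (circuit n) d)) 0 (cyc n_gt0 (m + d))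
    + v 0 (cyc n_gt0 (m + d)) =
  \sum_(t < (2 * d).+1) v 0 (cyc n_gt0 (m + t)).
Proof.
move=> d_gt0 lt_dn; set x := cyc n_gt0 (m + d).
have n_gt1 : (1 < n)%N by lia.
have inj : injective (fun t : 'I_(2 * d).+1 => cyc n_gt0 (m + t)).
  by apply: cyc_window_inj; lia.
have nbh y : (y \in (fun t : 'I_(2 * d).+1 => cyc n_gt0 (m + t)) @: setT)
    = (y == x) || dist_power (circuit n) d y x.
  rewrite dist_power_sym; last exact: circuit_sym.
  apply/imsetP/orP => [[t _ ->]|].
    have [-> | /eqP ne] := eqVneq (cyc n_gt0 (m + t)) x; [by left | right].
    apply/dist_powerP => //; first exact: circuit_irr.
    split; first by move/esym.
    by apply/circuit_ballP => //; exists t => //; rewrite -ltnS.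
  have window : (exists2 t, (t <= 2 * d)%N & y = cyc n_gt0 (m + t)) ->
      exists2 t : 'I_(2 * d).+1, t \in setT & y = cyc n_gt0 (m + t).
    case=> t le_t ->; have lt_t : (t < (2 * d).+1)%N by [].
    by exists (Ordinal lt_t).
  case=> [/eqP yx | /dist_powerP]; last first.
    move=> /(_ (@circuit_irr n) d_gt0) [_ ball]; apply: window.
    exact/circuit_ballP.
  by apply: window; exists d => //; lia.
rewrite [RHS](eq_bigl [in setT]) => [|t]; last by rewrite inE.
rewrite -(big_imset (fun y => v 0 y) (in2W inj)) /=.
rewrite (bigD1 x) /=; last by rewrite nbh eqxx.
rewrite addrC; congr (_ + _); rewrite mxE.
rewrite [LHS](bigID (fun y => dist_power (circuit n) d y x)) /=.
rewrite [X in _ + X]big1 ?addr0 => [|y /negbTE ne]; last first.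
  by rewrite mxE ne mulr0.
apply: eq_big => [y|y xy]; last by rewrite mxE xy mulr1.
rewrite nbh; have [-> | _] := eqVneq y x; last by rewrite andbT.
by rewrite dist_power_irr ?andbF //; apply: circuit_irr.
Qed.

(** * Descent for periodic integer sequences *)

Lemma periodicM (T : Type) (n : nat) (u : nat -> T) :
  (forall i, u (i + n)%N = u i) -> forall k i, u (i + k * n)%N = u i.
Proof.
move=> per; elim=> [|k IHk] i; first by rewrite addn0.
by rewrite mulSn addnCA addnC per.
Qed.

Lemma periodic_arith_const (n : nat) (f : nat -> int) (e : int) :
  (0 < n)%N -> (forall i, f (i + n)%N = f i) ->
  (forall i, f i.+1 - f i = e) -> e = 0.
Proof.
move=> n_gt0 per arith.
have lin i : f i = f 0%N + e * i%:Z.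
  elim: i => [|i IHi]; first by rewrite mulr0 addr0.
  by have := arith i; rewrite IHi; lia.
have := per 0%N; rewrite (lin (0 + n)%N) add0n => /eqP.
by rewrite -subr_eq0 addrAC subrr add0r mulf_eq0 => /orP[/eqP // | /eqP]; lia.
Qed.

(** The recurrence is linear and invariant under shifts, so the differences
    u' j = u (j + b + 1) - u (j + b) satisfy it too, and |c| >= 3 makes them
    strictly smaller than u: the induction is on a bound M for |u|. *)
Lemma periodic_descent (n a b : nat) (c : int) (u : nat -> int) :
  (0 < n)%N -> 3 <= `|c| -> (forall i, u (i + n)%N = u i) ->
  (forall i, u (i + a)%N - u i = c * (u (i + b).+1 - u (i + b)%N)) ->
  forall i, u i = u 0%N.
Proof.
move=> n_gt0 c_ge3.
suff descent (M : nat) : forall u : nat -> int,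
    (forall i, `|u i| <= M%:Z) -> (forall i, u (i + n)%N = u i) ->
    (forall i, u (i + a)%N - u i = c * (u (i + b).+1 - u (i + b)%N)) ->
    forall i, u i = u 0%N.
  move=> per; apply: (descent (\max_(i < n) `|u i|%N)) => // i.
  rewrite (divn_eq i n) addnC periodicM // -abszE lez_nat.
  exact: (leq_bigmax (Ordinal (ltn_pmod i n_gt0))).
elim: M => [|M IHM] {}u bnd per rel i.
  by have := bnd i; have := bnd 0%N; rewrite !normr_le0 => /eqP -> /eqP ->.
pose u' j := u (j + b).+1 - u (j + b)%N.
have per' j : u' (j + n)%N = u' j.
  by rewrite /u' addnAC per -addSn per.
have u'_const : forall j, u' j = u' 0%N.
  apply: IHM => // j.
    (* 3 |u' j| <= |c| |u' j| <= 2 (M + 1) < 3 (M + 1). *)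
    have := ler_normB (u (j + a)%N) (u j); rewrite rel normrM -/(u' j).
    have := bnd (j + a)%N; have := bnd j.
    have := ler_wpM2r (normr_ge0 (u' j)) c_ge3.
    lia.
  rewrite /u' [(j + a + b)%N]addnAC mulrBr -!rel addSn; ring.
have u'0 : u' 0%N = 0.
  apply: (periodic_arith_const n (fun j => u (j + b)%N)) => // j.
  by rewrite addnAC per.
have step j : u (j + b).+1 = u (j + b)%N.
  by apply/eqP; rewrite -subr_eq0 -/(u' j) u'_const u'0.
have tail j : u (j + b)%N = u b.
  by elim: j => [|j IHj] //; rewrite addSn step.
(* Shifting an index by b periods brings it beyond b. *)
have const j : u j = u b.
  have -> : u j = u (j + b * n - b + b)%N.
    by rewrite subnK ?(periodicM _ _ _ per) //; nia.
  exact: tail.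
by rewrite !const.
Qed.

(** * Integer eigenvalues of the distance power *)

(** The determinant of z - A is an integer, so its vanishing does not depend on
    the field of scalars, and over an integral domain a singular matrix has a
    nonzero kernel vector with entries in that domain. *)
Lemma eigenvalue_int (R : numFieldType) (n : nat) (A : 'M[int]_n) (z : int) :
  eigenvalue (map_mx intr A : 'M[R]_n) z%:~R ->
  exists2 v : 'rV[int]_n, v != 0 & v *m A = z *: v.
Proof.
case/eigenvalueP=> v vA v_neq0.
have /det0P[w w_neq0 wA] : \det (z%:M - A) == 0.
  rewrite -(intr_eq0 R) -det_map_mx; apply/det0P; exists v => //.
  by rewrite map_mxB map_scalar_mx mulmxBr vA mul_mx_scalar subrr.
exists w => //; apply/esym/eqP.
by rewrite -subr_eq0 -mul_mx_scalar -mulmxBr wA.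
Qed.

Theorem proposition4 (R : numFieldType) (n d : nat)
    (hn : (0 < n)%N) (hd : (1 <= d)%N) (hdn : (2 * d < n - 1)%N) :
  forall z : int,
    eigenvalue (adjmx R (dist_power (circuit n) d)) z%:~R ->
    z \in [:: -3; -2; -1; 0; 1; (2 * d)%:Z].
Proof.
move=> z.
have -> : adjmx R (dist_power (circuit n) d)
    = map_mx intr (adjmx int (dist_power (circuit n) d)).
  by apply/matrixP => i j; rewrite !mxE; case: dist_power.
case/eigenvalue_int=> v v_neq0 vA.
pose u i : int := v 0 (cyc hn i).
have window m : \sum_(t < (2 * d).+1) u (m + t)%N = (z + 1) * u (m + d)%N.
  by rewrite -adjmx_circuit_window // vA mxE mulrDl mul1r.
case: (lerP 3 `|z + 1|) => [c_ge3 | ]; last first.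
  by rewrite !inE; lia.
have u_const : forall i, u i = u 0%N.
  apply: (periodic_descent n (2 * d).+1 d (z + 1)) => // [i|i].
    by rewrite /u cycD.
  (* The windows at i + 1 and i share their middle terms. *)
  rewrite mulrBr -addSn -!window [in RHS]big_ord_recr /= (big_ord_recl (2 * d)).
  rewrite /= addn0 addSnnS.
  under eq_bigr => t _ do rewrite addSnnS.
  by rewrite opprD addrACA addrC; ring.
have u0_neq0 : u 0%N != 0.
  apply: contraNneq v_neq0 => u0; apply/eqP/rowP => i.
  by rewrite mxE -(cyc_val n hn i) -/(u i) u_const.
have := window 0%N; under eq_bigr => t _ do rewrite u_const.
rewrite sumr_const card_ord (u_const (0 + d)%N) => eq_u0.
rewrite -[LHS]mulr_natl in eq_u0.
by have := mulIf u0_neq0 eq_u0; rewrite !inE; lia.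
Qed.
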